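(* Let $s \to \infty$ and let $a = a(s)$ be a nonnegative integer with $a = o(s)$. Then \[ r(s, s+a) \ge (1+o(1)) \frac{s}{e} \cdot 2^{(s+a-1)/2 - a^2/(2s)}. \]
   Context: For positive integers $s,k$, the Ramsey number $r(s,k)$ is the minimum integer $n$ such that every graph on $n$ vertices contains a clique of size $s$ or an independent set of size $k$. Asymptotic notation is with respect to $s \to \infty$. *)

(* Defs.v *)
From mathcomp Require Import all_boot.
From Stdlib Require Import ClassicalEpsilon.

Set Implicit Arguments. Unset Strict Implicit. Unset Printing Implicit Defensive.

Definition is_graph n (e : rel 'I_n) : Prop := symmetric e /\ irreflexive e.

Definition is_clique n (e : rel 'I_n) (A : {set 'I_n}) : Prop :=
  forall x y, x \in A -> y \in A -> x != y -> e x y.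

Definition is_indep n (e : rel 'I_n) (A : {set 'I_n}) : Prop :=
  forall x y, x \in A -> y \in A -> x != y -> ~~ e x y.

Definition ramsey_prop (s k n : nat) : Prop :=
  forall e : rel 'I_n, is_graph e ->
    exists A : {set 'I_n},
      (#|A| = s /\ is_clique e A) \/ (#|A| = k /\ is_indep e A).

(* r(s,k): the minimum n with ramsey_prop s k n (exists by Ramsey's theorem). *)
Definition ramsey (s k : nat) : nat :=
  epsilon (inhabits 0%N)
    (fun n => ramsey_prop s k n /\ forall m, ramsey_prop s k m -> (n <= m)%N).

(* Main.v *)
(** Attach to every vertex [i] of an [n]-set a uniformly random pair [(x_i, y_i)]
    of vectors over [F_2] of dimension [t = s - 2], and join [i < j] when
    [(x_i - x_j) . y_j = 1].  In a clique each [x_j] lies outside the affine span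
    of the previous ones, so no clique has [t + 2 = s] vertices.  In an
    independent set [y_j] annihilates the direction of the affine span of the
    [x_i] with [i <= j]; if this span has dimension [r] before step [j], the step
    has probability [2^-(t-r) * 2^-r = 2^-t] when [x_j] lies in the span and at
    most [2^-(r+1)] otherwise, the latter for at most [t] steps.  Hence, up to a
    factor [2^o(s)] coming from the choice of those steps (here [a = o(s)] is
    used), a set of size [k = s + a] is independent with probability at most
    [2^-(C(k,2) - C(a,2))], and a union bound over the [k]-sets concludes. *)

From mathcomp Require all_boot all_algebra mxabelem zify.
Require Import Defs.

Module Combinatorics.
Import all_boot all_algebra mxabelem zify.
Set Implicit Arguments. Unset Strict Implicit. Unset Printing Implicit Defensive.
Import GRing.Theory.

(** * Sums over all words of given length: counting in place of probability *)

Fixpoint word_sum (W : finType) n (F : seq W -> nat) : nat :=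
  if n is m.+1 then \sum_(w : W) word_sum m (fun l => F (w :: l)) else F [::].

Lemma leq_word_sum (W : finType) n (F G : seq W -> nat) :
  (forall l, F l <= G l) -> word_sum n F <= word_sum n G.
Proof.
elim: n F G => [|n IH] F G leFG /=; first exact: leFG.
by apply: leq_sum => w _; apply: IH => l; apply: leFG.
Qed.

Lemma word_sumMl (W : finType) n c (F : seq W -> nat) :
  word_sum n (fun l => c * F l) = c * word_sum n F.
Proof.
elim: n F => //= n IH F; rewrite big_distrr /=.
by apply: eq_bigr => w _; rewrite IH.
Qed.

Lemma word_sum_exchange (W I : finType) (P : pred I) n (F : I -> seq W -> nat) :
  word_sum n (fun l => \sum_(i | P i) F i l) = \sum_(i | P i) word_sum n (F i).
Proof.
by elim: n F => //= n IH F; rewrite exchange_big /=; apply: eq_bigr => w _; rewrite IH.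
Qed.

(** First moment method: a nonnegative integer quantity of average below 1 vanishes somewhere. *)
Lemma word_sum_zero (W : finType) n (F : seq W -> nat) :
  word_sum n F < #|W| ^ n -> exists2 l, size l = n & F l = 0.
Proof.
elim: n F => [|n IH] F /=.
  by rewrite expn0 ltnS leqn0 => /eqP F0; exists [::].
move=> lt_sum.
have [w ltw] : exists w, word_sum n (fun l => F (w :: l)) < #|W| ^ n.
  apply/existsP; apply: contraLR lt_sum; rewrite negb_exists -leqNgt => /forallP geW.
  rewrite expnS -sum_nat_const; apply: leq_sum => w _.
  by rewrite leqNgt.
by have [l sz_l Fl] := IH _ ltw; exists (w :: l) => //=; rewrite sz_l.
Qed.

(** A uniform word restricted to the selected positions is again uniform; each discarded letter is
    free and contributes a factor [#|W|]. *)
Lemma word_sum_mask (W : finType) m (F : seq W -> nat) :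
  word_sum (size m) (fun l => F (mask m l))
    = #|W| ^ (size m - count id m) * word_sum (count id m) F.
Proof.
elim: m F => [|[] m IH] F /=; first by rewrite mul1n.
  rewrite add1n subSS big_distrr /=; apply: eq_bigr => w _.
  exact: (IH (fun l => F (w :: l))).
rewrite add0n subSn ?count_size // expnS -mulnA -IH sum_nat_const.
by [].
Qed.

(** * The random bilinear graph over F_2: cliques and independent sets *)

Section BilinearGraph.

Variable t : nat.
Let vertex := ('rV['F_2]_t * 'cV['F_2]_t)%type.

Definition form (p q : vertex) : 'F_2 := (((p.1 - q.1) *m q.2) ord0 ord0)%R.

(* [b] is the first vector of the sequence and [V] the direction of the affine
   span of the vectors preceding [l]. *)
Definition extends c (V : 'M['F_2]_t) (b : 'rV['F_2]_t) (l : seq vertex) :=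
  all (fun w => (V *m w.2 == 0)%R && (((b - w.1) *m w.2) ord0 ord0 == c)%R) l
  && pairwise (fun p q => form p q == c) l.

(** For a later vertex p, both b and [w.1] give the value c in (. - x_p) . y_p; subtracting, y_p
    annihilates [w.1 - b], which may therefore be added to V. *)
Lemma extends_cons c V b w l :
  extends c V b (w :: l) ->
  [/\ (V *m w.2 = 0)%R, ((b - w.1) *m w.2)%R ord0 ord0 = c
    & extends c (V + (w.1 - b)%R)%MS b l].
Proof.
rewrite /extends /= => /andP[/andP[/andP[/eqP Vw /eqP bw] all_l]] /andP[all_w pw_l].
split=> //; apply/andP; split=> //.
apply/allP => p p_l; have /andP[/eqP Vp bp] := allP all_l _ p_l.
have /eqP wp := allP all_w _ p_l; rewrite bp andbT.
have : ((V + (w.1 - b)%R)%MS <= (kermx p.2))%MS.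
  rewrite addsmx_sub !sub_kermx Vp eqxx /=.
  have -> : (w.1 - b = w.1 - p.1 - (b - p.1))%R by rewrite opprB addrA subrK.
  rewrite mulmxBl subr_eq0.
  by apply/eqP/matrixP => i j; rewrite !ord1 [LHS]wp (eqP bp).
by rewrite sub_kermx.
Qed.

Lemma rank_adds_row (V : 'M['F_2]_t) (v : 'rV['F_2]_t) :
  \rank (V + v)%MS = \rank V + ~~ (v <= V)%MS.
Proof.
have [vV | vV] := boolP (v <= V)%MS; first by rewrite addn0 (addsmx_idPl vV).
apply/eqP; rewrite addn1 eqn_leq; apply/andP; split.
  by rewrite (leq_trans (mxrank_adds_leqif _ _)) // -[X in _ <= X]addn1 leq_add2l rank_leq_row.
by apply: rank_ltmx; rewrite ltmxE addsmxSl addsmx_sub submx_refl.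
Qed.

Lemma clique_size V b l : extends 1%R V b l -> size l + \rank V <= t.
Proof.
elim: l V => [|w l IH] V; first by rewrite rank_leq_row.
case/extends_cons => Vw bw /IH; rewrite rank_adds_row.
suff -> : ~~ ((w.1 - b)%R <= V)%MS by rewrite addn1 addnS.
(* A vector [w.1 - b] lying in V would be annihilated by [w.2], but the pairing is nonzero; so the
   rank grows at every step. *)
apply/negP => /submxP[d def_d].
have : ((w.1 - b) *m w.2 == 0)%R by rewrite def_d -mulmxA Vw mulmx0.
by rewrite -opprB mulNmx oppr_eq0 => /eqP E; move: bw; rewrite E mxE.
Qed.

Lemma card_submx_row (V : 'M['F_2]_t) (b : 'rV['F_2]_t) :
  #|[pred x | ((x - b)%R <= V)%MS]| = 2 ^ \rank V.
Proof.
have <- : #|rowg V| = 2 ^ \rank V by rewrite card_rowg card_Fp.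
rewrite -[RHS](card_imset _ (@addrI _ b)); apply: eq_card => x.
rewrite inE; apply/idP/imsetP => [xV | [y]].
  by exists (x - b)%R; rewrite ?mem_rowg // addrC subrK.
by rewrite mem_rowg => yV ->; rewrite addrC addKr.
Qed.

Lemma card_perp (V : 'M['F_2]_t) :
  #|[pred y : 'cV['F_2]_t | (V *m y == 0)%R]| = 2 ^ (t - \rank V).
Proof.
rewrite -(mxrank_tr V) -mxrank_ker -(card_submx_row _ 0%R).
rewrite -[LHS](card_imset _ (@trmx_inj _ _ _)); apply: eq_card => x.
rewrite [RHS]inE subr0 sub_kermx; apply/imsetP/eqP => [[y] | xV].
  by rewrite inE => /eqP Vy ->; rewrite -trmx_mul Vy trmx0.
exists (x^T)%R; last by rewrite trmxK.
by rewrite inE -(trmxK V) -trmx_mul xV trmx0.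
Qed.

(** When c = 0, the conditions on the first vertex (x, y) say that y annihilates V and x - b. By
    [card_perp] this fixes the number of choices of y, and what remains depends on x only. *)
Lemma extends_step k V b :
  word_sum k.+1 (extends 0%R V b)
    <= \sum_(x : 'rV['F_2]_t)
         2 ^ (t - \rank (V + (x - b)%R)%MS)
           * word_sum k (extends 0%R (V + (x - b)%R)%MS b).
Proof.
pose V' x := (V + (x - b)%R)%MS.
pose F x := word_sum k (extends 0%R (V' x) b).
have -> : \sum_x 2 ^ (t - \rank (V' x)) * F x
        = \sum_(w : vertex) (V' w.1 *m w.2 == 0)%R * F w.1 :> nat.
  transitivity (\sum_(x : 'rV['F_2]_t) \sum_(y : 'cV['F_2]_t) (V' x *m y == 0)%R * F x); last exact: pair_big.
  apply: eq_bigr => x _; rewrite -card_perp -big_distrl /= -sum1_card big_mkcond.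
  by congr (_ * _); apply: eq_bigr => y _; rewrite inE; case: eqP.
apply: leq_sum => w _; rewrite -word_sumMl; apply: leq_word_sum => l.
have [/extends_cons[Vw bw ->] | //] := boolP (extends _ _ _ (w :: l)).
rewrite muln1 lt0b /V' -sub_kermx addsmx_sub !sub_kermx Vw eqxx /=.
by rewrite -opprB mulNmx oppr_eq0; apply/eqP/matrixP => i j; rewrite !ord1 bw mxE.
Qed.

Lemma bin2_mul2 m : 'C(m, 2) * 2 = m * m.-1.
Proof. by rewrite -[X in _ * X]/(2`!) bin_ffact 2!ffactnS ffactn0 muln1. Qed.

(** Twice the difference of the exponents is (c - d)(c - d + 1), a product of consecutive integers,
    hence nonnegative. This supplies K for z = 2^c in [card_extends]. *)
Lemma expn_quadratic_bound c d : (2 ^ c) ^ d <= 2 ^ 'C(c.+1, 2) * 2 ^ 'C(d, 2).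
Proof.
rewrite -expnM -expnD leq_exp2l //.
have := bin2_mul2 c.+1; have := bin2_mul2 d; case: d => [|d] /=; first by lia.
by have [/subnKC <- | /subnKC <-] := leqP c d; set e := _ - _; nia.
Qed.

(* The parameter [z] weighs the steps that enlarge the span: a vertex inside the
   span multiplies the bound by [2 ^ t], one outside it by [z * 2 ^ t].  The
   factor [z ^ t] on the left is later played against [z.+1 ^ k]. *)
Lemma card_extends z K k V b :
  (forall d, z ^ d <= K * 2 ^ 'C(d, 2)) ->
  word_sum k (extends 0%R V b) * z ^ (t - \rank V)
    <= z.+1 ^ k * 2 ^ (t * k) * (K * 2 ^ 'C(t - \rank V, 2)).
Proof.
move=> zK; elim: k V => [|k IH] V.
  by rewrite muln0 !expn0 !mul1n /=; exact: zK.
set r := \rank V; set d := t - r.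
set B := z.+1 ^ k * 2 ^ (t * k) * K; set Cd := 2 ^ 'C(d, 2).
apply: leq_trans (leq_mul (extends_step _ _ _) (leqnn _)) _.
rewrite big_distrl /= (bigID (fun x => (x - b)%R <= V)%MS) /=.
(* Split z + 1 as 1 + z: the first summand pays for the 2^r vectors x with x - b in V, the second
   for all others, counted as if there were 2^t of them. *)
have -> : z.+1 ^ k.+1 * 2 ^ (t * k.+1) * (K * Cd)
        = 2 ^ r * (2 ^ d * (B * Cd)) + 2 ^ t * (z * B * Cd).
  rewrite [2 ^ r * _]mulnA -expnD subnKC ?rank_leq_row // mulnS expnD expnS /B; lia.
apply: leq_add.
  rewrite -(card_submx_row V b) -sum_nat_const; apply: leq_sum => x xV.
  rewrite rank_adds_row xV addn0 -/r -/d -mulnA leq_mul2l; apply/orP; right.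
  by have := IH (V + (x - b)%R)%MS; rewrite rank_adds_row xV addn0 -/r -/d -/Cd /B mulnA.
have <- : #|'rV['F_2]_t| = 2 ^ t by rewrite card_mx card_Fp // mul1n.
rewrite -sum_nat_const [X in _ <= X](bigID (fun x => (x - b)%R <= V)%MS) /=.
apply: leq_trans (leq_addl _ _); apply: leq_sum => x xV.
have := rank_leq_row (V + (x - b)%R)%MS; rewrite rank_adds_row xV addn1 -/r => lt_rt.
have := IH (V + (x - b)%R)%MS; rewrite rank_adds_row xV addn1 -/r.
have -> : d = (t - r.+1).+1 by rewrite /d subnSK.
rewrite /Cd /d -(subnSK lt_rt); set d' := t - r.+1.
(* With d = d' + 1, the difference C(d, 2) - C(d', 2) = d' absorbs the 2^d' choices of y, and
   passing from z^d' to z^d costs the factor z. *)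
rewrite binS bin1 expnD expnS mulnA -/B => IHx.
rewrite -mulnA [_ * (z * _)]mulnCA; apply: leq_trans (leq_mul (leqnn _) (leq_mul (leqnn _) IHx)) _.
lia.
Qed.

Lemma card_vertex : #|{: vertex}| = 2 ^ t * 2 ^ t.
Proof. by rewrite card_prod !card_mx card_Fp // mul1n muln1. Qed.

Lemma pairwise_extends c w l :
  pairwise (fun p q => form p q == c) (w :: l) -> extends c 0%R w.1 l.
Proof.
rewrite /extends /= => /andP[/allP wl ->]; rewrite andbT.
by apply/allP => p /wl; rewrite mul0mx eqxx.
Qed.

Lemma card_indep_words z K k :
  (forall d, z ^ d <= K * 2 ^ 'C(d, 2)) ->
  word_sum k.+1 (pairwise (fun p q => form p q == 0%R)) * z ^ t
    <= #|{: vertex}| * (z.+1 ^ k * 2 ^ (t * k) * (K * 2 ^ 'C(t, 2))).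
Proof.
move=> zK; rewrite /= big_distrl -sum_nat_const; apply: leq_sum => w _.
have := card_extends k 0%R w.1 zK; rewrite mxrank0 subn0; apply: leq_trans.
rewrite leq_mul2r; apply/orP; right; apply: leq_word_sum => l.
by have /= := @pairwise_extends 0%R w l; case: (_ && _) => // ->.
Qed.

(** As a bit sequence, A selects by [mask] its subword in increasing order of indices, the order in
    which the arcs are oriented. *)
Definition set_mask n (A : {set 'I_n}) : bitseq := [seq i \in A | i <- enum 'I_n].

Lemma size_set_mask n (A : {set 'I_n}) : size (set_mask A) = n.
Proof. by rewrite size_map size_enum_ord. Qed.

Lemma count_set_mask n (A : {set 'I_n}) : count id (set_mask A) = #|A|.
Proof. by rewrite count_map -sum1_count -[RHS]sum1_card big_enum_cond; apply: eq_bigl. Qed.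

Lemma pairwise_set_mask n (A : {set 'I_n}) (W : Type) (w0 : W) (R : rel W) u :
  size u = n ->
  (forall i j : 'I_n, i \in A -> j \in A -> i < j -> R (nth w0 u i) (nth w0 u j)) ->
  pairwise R (mask (set_mask A) u).
Proof.
move=> sz_u RA.
have -> : u = [seq nth w0 u (val i) | i <- enum 'I_n].
  by rewrite (map_comp (nth w0 u) val) val_enum_ord -sz_u map_nth_iota0 // take_size.
rewrite -map_mask -filter_mask pairwise_map.
apply: (@sub_in_pairwise _ (mem A) (relpre val ltn)) => [i j iA jA lt_ij||].
- exact: RA.
- exact: filter_all.
apply: pairwise_filter; rewrite -pairwise_map val_enum_ord -sorted_pairwise.
  exact: iota_ltn_sorted.
exact: ltn_trans.
Qed.

(** By [card_indep_words], the inequality makes the average number of independent sets of size k + 1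
    less than 1, so some word has none; no word gives a clique of size t + 2. *)
Lemma not_ramsey_prop z K k n :
  (forall d, z ^ d <= K * 2 ^ 'C(d, 2)) ->
  'C(n, k.+1) * (z.+1 ^ k * (K * 2 ^ 'C(t, 2))) < z ^ t * 2 ^ (t * k) ->
  ~ ramsey_prop t.+2 k.+1 n.
Proof.
move=> zK few ramsey_n.
pose indep := pairwise (fun p q : vertex => form p q == 0%R).
have [u sz_u] : exists2 u : seq vertex, size u = n
    & \sum_(A : {set 'I_n} | #|A| == k.+1) indep (mask (set_mask A) u) = 0.
  apply: word_sum_zero; rewrite word_sum_exchange.
  (* If n < k + 1 the sum is empty; otherwise the truncated subtraction n - (k + 1) is exact. *)
  have [lt_nk | le_kn] := ltnP n k.+1.
    rewrite big1 => [|A /eqP cardA]; first by rewrite expn_gt0 card_vertex muln_gt0 !expn_gt0.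
    by have := max_card (mem A); rewrite cardA card_ord leqNgt lt_nk.
  rewrite (eq_bigr (fun=> #|{: vertex}| ^ (n - k.+1) * word_sum k.+1 indep)); last first.
    move=> A /eqP cardA; rewrite -{1}(size_set_mask A).
    by rewrite (word_sum_mask _ (fun l => indep l : nat)) count_set_mask cardA size_set_mask.
  rewrite (eq_bigl (fun A => A \in [set A : {set 'I_n} | #|A| == k.+1])); last first.
    by move=> A; rewrite inE.
  rewrite sum_nat_const card_draws card_ord.
  have zt_gt0 : 0 < z ^ t by apply: contraLR few; rewrite -leqNgt leqn0 => /eqP ->.
  rewrite -(ltn_pmul2r zt_gt0) -mulnA -mulnA.
  have := card_indep_words k zK; rewrite -/indep.
  rewrite -[in X in _ -> _ < X](subnK le_kn) expnD expnS card_vertex.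
  set N := _ ^ (n - _); set w := word_sum _ _.
  have -> : (2 ^ t * 2 ^ t) ^ k = 2 ^ (t * k) * 2 ^ (t * k) by rewrite expnMn -expnM.
  have N_gt0 : 0 < N by rewrite expn_gt0 muln_gt0 !expn_gt0.
  have T_gt0 : 0 < 2 ^ t by rewrite expn_gt0.
  have Tk_gt0 : 0 < 2 ^ (t * k) by rewrite expn_gt0.
  move: (_ ^ t) (_ ^ (t * k)) N_gt0 T_gt0 Tk_gt0 few => T Tk N_gt0 T_gt0 Tk_gt0 few le_w.
  rewrite mulnCA -!mulnA ltn_pmul2l //; apply: leq_ltn_trans (leq_mul (leqnn _) le_w) _.
  move: few; move: (z ^ t) (z.+1 ^ k) (K * _) 'C(n, _) => zt zk K' c few.
  have -> : c * (T * T * (zk * Tk * K')) = T * (T * (Tk * (c * (zk * K')))) by lia.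
  have -> : T * (T * (Tk * (Tk * zt))) = T * (T * (Tk * (zt * Tk))) by lia.
  by rewrite !ltn_pmul2l.
move/eqP; rewrite sum_nat_eq0 => /forall_inP no_indep.
pose w0 : vertex := (0, 0)%R.
pose arc (i j : 'I_n) := (i < j) && (form (nth w0 u i) (nth w0 u j) == 1%R).
have graph_arc : is_graph (fun i j => arc i j || arc j i).
  by split=> [i j | i]; rewrite /arc ?ltnn // orbC.
have [A [[cardA cliqueA] | [cardA indepA]]] := ramsey_n _ graph_arc.
  have : pairwise (fun p q => form p q == 1%R) (mask (set_mask A) u).
    apply: (pairwise_set_mask (w0 := w0)) => // i j iA jA lt_ij.
    have := cliqueA i j iA jA; rewrite /arc -val_eqE neq_ltn lt_ij [j < i]ltnNge (ltnW lt_ij) /= orbF.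
    by apply.
  have : size (mask (set_mask A) u) = t.+2.
    by rewrite size_mask ?count_set_mask // size_set_mask.
  (* The first vertex of the clique serves as base point, and the t + 1 others exceed the bound t of
     [clique_size]. *)
  case: (mask _ u) => // w l [sz_l] /pairwise_extends /clique_size.
  by rewrite mxrank0 addn0 sz_l ltnn.
have := no_indep A; rewrite cardA eqxx => /(_ isT).
suff -> : indep (mask (set_mask A) u) by [].
apply: (pairwise_set_mask (w0 := w0)) => // i j iA jA lt_ij.
have := indepA i j iA jA; rewrite /arc -val_eqE neq_ltn lt_ij [j < i]ltnNge (ltnW lt_ij) /= orbF.
by move=> /(_ isT); case: (form _ _) => [[|[|m]]].
Qed.

End BilinearGraph.

(** * Finiteness of Ramsey numbers *)

Lemma ramsey_subset s k : exists N, forall n (e : rel 'I_n) (B : {set 'I_n}),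
  symmetric e -> N <= #|B| ->
  exists2 A : {set 'I_n}, A \subset B
    & (#|A| = s /\ is_clique e A) \/ (#|A| = k /\ is_indep e A).
Proof.
elim: s k => [|s IHs] k.
  exists 0 => n e B _ _; exists set0; rewrite ?sub0set //; left.
  by rewrite cards0; split=> // x y; rewrite inE.
elim: k => [|k [N2 IH2]].
  exists 0 => n e B _ _; exists set0; rewrite ?sub0set //; right.
  by rewrite cards0; split=> // x y; rewrite inE.
have [N1 IH1] := IHs k.+1; exists (N1 + N2).+1 => n e B sym_e leB.
have [v vB] : exists v, v \in B by apply/card_gt0P; apply: leq_trans leB.
rewrite (cardsD1 v B) vB add1n ltnS -(cardsID [set x | e v x] (B :\ v)) in leB.
(* Either the neighbours or the non-neighbours of v in B are numerous enough. Working with subsets B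
   of a fixed vertex set avoids renumbering when passing to them. *)
have [le1 | lt1] := leqP N1 #|(B :\ v) :&: [set x | e v x]|.
  have [A /subsetP sAB] := IH1 n e _ sym_e le1.
  have sA x : x \in A -> [/\ x != v, x \in B & e v x].
    by move/sAB; rewrite !inE => /andP[/andP[? ?] ?].
  have sAB' : A \subset B by apply/subsetP => x /sA[].
  case=> [[cardA cliqueA] | ?]; last by exists A => //; right.
  have vA : v \notin A by apply/negP => /sA[/eqP].
  exists (v |: A); first by rewrite subUset sub1set vB.
  left; split; first by rewrite cardsU1 vA cardA.
  move=> x y; rewrite !inE => /predU1P[-> | xA] /predU1P[-> | yA]; first by rewrite eqxx.
  - by case/sA: yA.
  - by rewrite sym_e; case/sA: xA.
  - exact: cliqueA.
have le2 : N2 <= #|(B :\ v) :\: [set x | e v x]|.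
  by move: leB lt1; move: #|_ :&: _| #|_ :\: _| => p q; lia.
have [A /subsetP sAB] := IH2 n e _ sym_e le2.
have sA x : x \in A -> [/\ x != v, x \in B & ~~ e v x].
  by move/sAB; rewrite !inE => /andP[? /andP[? ?]].
have sAB' : A \subset B by apply/subsetP => x /sA[].
case=> [? | [cardA indepA]]; first by exists A => //; left.
have vA : v \notin A by apply/negP => /sA[/eqP].
exists (v |: A); first by rewrite subUset sub1set vB.
right; split; first by rewrite cardsU1 vA cardA.
move=> x y; rewrite !inE => /predU1P[-> | xA] /predU1P[-> | yA]; first by rewrite eqxx.
- by case/sA: yA.
- by rewrite sym_e; case/sA: xA.
- exact: indepA.
Qed.

(** The [epsilon] in [ramsey] is meaningful only once a least n is known to exist; finiteness and
    descent provide it. *)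
Lemma ramsey_prop_ramsey s k : ramsey_prop s k (ramsey s k).
Proof.
have [N RN] := ramsey_subset s k.
have ram_N : ramsey_prop s k N.
  move=> e [sym_e _]; have [|A _] := RN N e setT sym_e; last by exists A.
  by rewrite cardsT card_ord.
suff : exists n, ramsey_prop s k n /\ forall m, ramsey_prop s k m -> n <= m.
  by case/(ClassicalEpsilon.epsilon_spec (inhabits 0)).
elim/ltn_ind: N {RN} ram_N => N IH ram_N.
have [[m [ltmN ram_m]] | no_less] :=
    ClassicalEpsilon.excluded_middle_informative (exists m, m < N /\ ramsey_prop s k m).
  exact: IH ram_m.
exists N; split=> // m ram_m; rewrite leqNgt; apply/negP => ltmN.
by apply: no_less; exists m.
Qed.

End Combinatorics.

From Stdlib Require Import Reals Lra Lia.
Open Scope R_scope.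

Module RealBound.
Import all_boot zify Combinatorics.
Local Open Scope nat_scope.
Local Open Scope R_scope.

(** * From the counting inequality to logarithms *)

Lemma pow_exp (x : R) (n : nat) : exp x ^ n = exp (INR n * x).
Proof.
elim: n => [|n IH]; first by rewrite Rmult_0_l exp_0.
by rewrite S_INR -tech_pow_Rmult IH -exp_plus; congr exp; ring.
Qed.

Lemma INR_expn (m n : nat) : INR (expn m n) = INR m ^ n.
Proof. by elim: n => // n IH; rewrite expnS mult_INR IH. Qed.

(** Induction through (1 + 1/k)^k <= e. It gives C(n, k) <= (e n / k)^k, the source of the factor s
    / e. *)
Lemma pow_le_factorial_exp (k : nat) : INR k ^ k <= INR (factorial k) * exp (INR k).
Proof.
elim: k => [|k IH]; first by rewrite /= exp_0; lra.
have step : INR k.+1 ^ k <= INR k ^ k * exp 1.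
  case: k {IH} => [|k]; first by rewrite /=; have := exp_ineq1_le 1; lra.
  have pos : 0 < INR k.+1 by exact/lt_0_INR/Nat.lt_0_succ.
  have -> : INR k.+2 = INR k.+1 * (1 + / INR k.+1) by rewrite (S_INR k.+1); field; lra.
  rewrite Rpow_mult_distr; apply: Rmult_le_compat_l; first by apply: pow_le; lra.
  have -> : exp 1 = exp (/ INR k.+1) ^ k.+1 by rewrite pow_exp Rinv_r //; lra.
  apply: pow_incr; have := Rinv_0_lt_compat _ pos.
  by have := exp_ineq1_le (/ INR k.+1); lra.
rewrite -tech_pow_Rmult factS mult_INR [in exp _]S_INR exp_plus Rmult_assoc.
apply: Rmult_le_compat_l; first exact: pos_INR.
apply: Rle_trans step _; rewrite -Rmult_assoc.
by apply: Rmult_le_compat_r IH; left; apply: exp_pos.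
Qed.

Lemma bin_mul_fact_le (n k : nat) : (binomial n k * factorial k <= n ^ k)%N.
Proof.
rewrite bin_ffact; elim: k => // k IH.
by rewrite ffactnSr expnSr leq_mul // leq_subr.
Qed.

Lemma INR_bin2 (n : nat) : INR (binomial n 2) = INR n * (INR n - 1) / 2.
Proof.
have := f_equal INR (bin2_mul2 n); rewrite !mult_INR /=; case: n => [|n]; first by rewrite /=; lra.
by rewrite S_INR /=; lra.
Qed.

(** Since r(s, k) has the Ramsey property, the inequality of [not_ramsey_prop] fails at n = r(s, k)
    with z = 2^c and K = 2^C(c+1, 2). Bounding the binomial by n^k / k! and taking logarithms gives
    this form. *)
Lemma ramsey_log_bound (t a c : nat) (beta : R) :
  let k := INR t + INR a + 2 in
  INR (ramsey t.+2 (t.+2 + a)) <= exp beta ->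
  k * ln k + (INR t * INR c + INR t * (INR t + INR a + 1)) * ln 2
    <= k * (beta + 1) + (INR t + INR a + 1) * ln (2 ^ c + 1)
       + (INR c * (INR c + 1) / 2 + INR t * (INR t - 1) / 2) * ln 2.
Proof.
set n := ramsey _ _; move=> k le_n.
pose k' := (t + a).+1.
have def_k : INR k'.+1 = k by rewrite /k /k' !S_INR plus_INR; ring.
have def_k' : INR k' = INR t + INR a + 1 by rewrite /k' !S_INR plus_INR.
have two : exp (ln 2) = 2 by apply: exp_ln; lra.
have not_few := not_ramsey_prop (expn_quadratic_bound c) (n := n) (k := k') (t := t).
have {not_few}many : (expn (expn 2 c) t * expn 2 (t * k')
    <= binomial n k'.+1 * (expn (expn 2 c).+1 k'
         * (expn 2 (binomial c.+1 2) * expn 2 (binomial t 2))))%N.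
  rewrite leqNgt; apply/negP => /not_few; apply.
  exact: (@ramsey_prop_ramsey t.+2 (t.+2 + a)).
have {}many : (factorial k'.+1 * (expn (expn 2 c) t * expn 2 (t * k'))
    <= expn n k'.+1 * (expn (expn 2 c).+1 k'
         * (expn 2 (binomial c.+1 2) * expn 2 (binomial t 2))))%N.
  apply: leq_trans (leq_mul (leqnn _) many) _; rewrite mulnA [X in (X * _ <= _)%N]mulnC.
  by rewrite leq_mul // bin_mul_fact_le.
have pow2 m : INR (expn 2 m) = exp (INR m * ln 2) by rewrite INR_expn -[INR 2]/2 -{1}two pow_exp.
have pos_c : 0 < 2 ^ c + 1 by have := pow_lt 2 c; lra.
have k_gt0 : 0 < k by have := pos_INR t; have := pos_INR a; rewrite /k; lra.
have lower := pow_le_factorial_exp k'.+1; rewrite def_k in lower.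
have {}many := le_INR _ _ (leP many).
rewrite (mult_INR (factorial _)) (mult_INR (expn (expn 2 c) t)) (mult_INR (expn n _))
  (mult_INR (expn _ k')) (mult_INR (expn 2 (binomial c.+1 2))) in many.
move: (factorial k'.+1) many lower => f; rewrite -expnM !pow2 !INR_expn S_INR INR_expn => many lower.
rewrite -[INR 2]/2 in many.
have upper : INR n ^ k'.+1 <= exp (k * beta).
  by rewrite -def_k -pow_exp; apply: pow_incr; split=> //; apply: pos_INR.
rewrite -{1}(exp_ln k) // pow_exp def_k in lower.
rewrite -(exp_ln (2 ^ c + 1)) // pow_exp def_k' in many.
rewrite !INR_bin2 (mult_INR c) (mult_INR t) def_k' S_INR in many.
rewrite -!exp_plus in many.
have : exp (k * ln k) * exp (INR c * INR t * ln 2 + INR t * (INR t + INR a + 1) * ln 2)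
   <= exp (k * beta) * exp k *
    exp ((INR t + INR a + 1) * ln (2 ^ c + 1)
     + ((INR c + 1) * (INR c + 1 - 1) / 2 * ln 2 + INR t * (INR t - 1) / 2 * ln 2)).
  set P := exp (_ + _) in many *; set Q := exp (_ + (_ + _)) in many *.
  have P_gt0 : 0 < P by apply: exp_pos.
  have Q_gt0 : 0 < Q by apply: exp_pos.
  have e_gt0 := exp_pos k.
  apply: (Rle_trans _ (INR f * exp k * P)).
    by apply: Rmult_le_compat_r lower; lra.
  have -> : INR f * exp k * P = (INR f * P) * exp k by ring.
  have -> : exp (k * beta) * exp k * Q = (exp (k * beta) * Q) * exp k by ring.
  apply: Rmult_le_compat_r; first lra.
  by apply: Rle_trans many _; apply: Rmult_le_compat_r upper; lra.
rewrite -!exp_plus => le_exp.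
have : ~ (_ < _) := fun lt => Rlt_irrefl _ (Rlt_le_trans _ _ _ (exp_increasing _ _ lt) le_exp).
by move/Rnot_lt_le; lra.
Qed.

End RealBound.

(** * Asymptotics: choice of parameters and comparison of error terms *)

Lemma ln_le_sub_1 (x : R) : 0 < x -> ln x <= x - 1.
Proof.
intros x_pos; apply Rnot_lt_le; intro lt.
generalize (exp_increasing _ _ lt) (exp_ineq1_le (x - 1)); rewrite (exp_ln x x_pos); lra.
Qed.

Lemma INR_le_pow2 (c : nat) : INR c <= 2 ^ c.
Proof.
induction c as [|c IH]; [simpl; lra|].
rewrite S_INR; simpl; generalize (pow_R1_Rle 2 c); lra.
Qed.

Theorem theorem1p5 (a : nat -> nat)
  (a_little_o : forall eps : R, 0 < eps ->
     exists S : nat, forall s : nat, (S <= s)%nat -> INR (a s) <= eps * INR s) :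
  forall eps : R, 0 < eps ->
  exists S : nat, forall s : nat, (S <= s)%nat ->
    (1 - eps) * (INR s / exp 1) *
      Rpower 2 ((INR s + INR (a s) - 1) / 2 - INR (a s) ^ 2 / (2 * INR s))
    <= INR (ramsey s (s + a s)).
Proof.
intros eps eps_pos.
assert (e_pos := exp_pos 1).
(* For eps >= 1 the left-hand side is at most 0; below, ln (1 - eps) must make sense. *)
destruct (Rle_or_lt 1 eps) as [ge1|lt1].
{ exists 0%nat; intros s _.
  apply Rle_trans with 0; [|apply pos_INR].
  assert (0 <= INR s / exp 1 * Rpower 2 ((INR s + INR (a s) - 1) / 2 - INR (a s) ^ 2 / (2 * INR s))).
  { apply Rmult_le_pos; [|left; apply exp_pos].
    apply Rmult_le_pos; [apply pos_INR|left; apply Rinv_0_lt_compat, e_pos]. }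
  rewrite Rmult_assoc; generalize (Rmult_le_pos (eps - 1) _ ltac:(lra) H); lra. }
(* With [z = 2 ^ c >= 4 / eps], the loss [(1 + 1 / z) ^ t] is at most [exp (eps * t / 4)]. *)
destruct (INR_unbounded (4 / eps)) as [c c_large].
set (C := INR c) in *; set (M := ln (2 ^ c + 1)).
assert (pow_pos : 0 < 2 ^ c) by (apply pow_lt; lra).
assert (C_nonneg : 0 <= C) by apply pos_INR.
assert (L_bounds : 0 < ln 2 <= 1).
{ split; [rewrite <- ln_1; apply ln_increasing; lra|].
  generalize (ln_le_sub_1 2); lra. }
assert (M_nonneg : 0 <= M).
{ unfold M; rewrite <- ln_1; left; apply ln_increasing; lra. }
assert (M_le : M <= C * ln 2 + eps / 4).
{ assert (inv_pos := Rinv_0_lt_compat _ pow_pos).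
  unfold M; replace (2 ^ c + 1) with (2 ^ c * (1 + / 2 ^ c)) by (field; lra).
  rewrite ln_mult, ln_pow; [|lra..].
  assert (small : / 2 ^ c <= eps / 4).
  { replace (eps / 4) with (/ (4 / eps)) by (field; lra).
    apply Rinv_le_contravar; [apply Rdiv_lt_0_compat; lra|].
    generalize (INR_le_pow2 c); fold C; lra. }
  generalize (ln_le_sub_1 (1 + / 2 ^ c)); fold C; lra. }
(* C and M depend on eps alone, so a = o(s) can be invoked at this precision; it yields [AM]. The
   threshold S2 makes the constant terms at most s eps / 8, as in [const]. *)
destruct (a_little_o (eps / (4 * (2 + M)))) as [S1 HS1].
{ apply Rdiv_lt_0_compat; lra. }
destruct (INR_unbounded ((1 + M + C * (C + 1) / 2) * (8 / eps))) as [S2 HS2].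
exists (S1 + S2 + 2)%nat; intros [|[|t]] s_large; [exfalso; lia..|].
assert (a_small : INR (a (S (S t))) <= eps / (4 * (2 + M)) * INR (S (S t))) by (apply HS1; lia).
assert (s_gt : INR S2 <= INR (S (S t))) by (apply le_INR; lia).
set (A := INR (a (S (S t)))) in *; set (s := INR (S (S t))) in *.
assert (def_s : s = INR t + 2) by (unfold s; rewrite 2!S_INR; ring).
assert (A_nonneg : 0 <= A) by apply pos_INR.
assert (t_nonneg : 0 <= INR t) by apply pos_INR.
assert (s_pos : 0 < s) by lra.
apply Rnot_lt_le; intro lt.
set (T := (s + A - 1) / 2 - A ^ 2 / (2 * s)) in *.
(* The logarithm of the claimed lower bound, assumed to exceed the Ramsey number. *)
set (beta := ln (1 - eps) + ln s - 1 + T * ln 2).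
assert (def_beta : exp beta = (1 - eps) * (s / exp 1) * Rpower 2 T).
{ unfold beta, Rpower, Rminus at 1; rewrite !exp_plus, exp_Ropp, !exp_ln by lra; field; lra. }
rewrite <- def_beta in lt.
assert (bound := RealBound.ramsey_log_bound t (a (S (S t))) c beta (Rlt_le _ _ lt)).
cbv zeta in bound; fold A C M in bound.
replace (INR t + A + 2) with (s + A) in bound by lra.
assert (beta_le : (s + A) * (beta + 1) <= (s + A) * (ln (s + A) - eps + T * ln 2)).
{ apply Rmult_le_compat_l; [lra|].
  assert (ln s <= ln (s + A)).
  { destruct (Req_dec A 0) as [-> | A_pos]; [rewrite Rplus_0_r; lra|].
    left; apply ln_increasing; lra. }
  unfold beta; generalize (ln_le_sub_1 (1 - eps)); lra. }
assert (tM_le : INR t * M <= INR t * (C * ln 2 + eps / 4)) by (apply Rmult_le_compat_l; lra).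
(* The quadratic terms cancel exactly because of the term A^2 / (2 s) in T; only a linear term in A
   and a constant survive. *)
assert (exponent : (s + A) * T - INR t * (INR t + A + 1) + INR t * (INR t - 1) / 2
                   <= 3 / 2 * A + 1).
{ replace ((s + A) * T - INR t * (INR t + A + 1) + INR t * (INR t - 1) / 2)
    with (3 / 2 * A + 1 - A ^ 3 / (2 * s)) by (unfold T; rewrite def_s; field; lra).
  assert (0 <= A ^ 3 / (2 * s)); [|lra].
  apply Rmult_le_pos; [apply pow_le; lra|left; apply Rinv_0_lt_compat; lra]. }
assert (exponentL : ((s + A) * T - INR t * (INR t + A + 1) + INR t * (INR t - 1) / 2) * ln 2
                   <= 3 / 2 * A + 1).
{ apply Rle_trans with ((3 / 2 * A + 1) * ln 2); [apply Rmult_le_compat_r; lra|].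
  rewrite <- (Rmult_1_r (3 / 2 * A + 1)) at 2; apply Rmult_le_compat_l; lra. }
assert (CL : C * (C + 1) / 2 * ln 2 <= C * (C + 1) / 2).
{ rewrite <- (Rmult_1_r (C * (C + 1) / 2)) at 2; apply Rmult_le_compat_l; [|lra].
  generalize (Rmult_le_pos C (C + 1)); lra. }
assert (AM : A * (2 + M) <= s * eps / 4).
{ replace (s * eps / 4) with (eps / (4 * (2 + M)) * s * (2 + M)) by (field; lra).
  apply Rmult_le_compat_r; lra. }
assert (const : 1 + M + C * (C + 1) / 2 <= s * eps / 8).
{ replace (1 + M + C * (C + 1) / 2)
    with ((1 + M + C * (C + 1) / 2) * (8 / eps) * (eps / 8)) by (field; lra).
  replace (s * eps / 8) with (s * (eps / 8)) by field.
  apply Rmult_le_compat_r; lra. }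
assert (s_eps := Rmult_lt_0_compat _ _ s_pos eps_pos).
assert (A_eps := Rmult_le_pos _ _ A_nonneg (Rlt_le _ _ eps_pos)).
assert (t_eps : INR t * eps <= s * eps) by (apply Rmult_le_compat_r; lra).
(* The gain (s + A) eps from ln (1 - eps) <= -eps would be at most the losses s eps / 4 (from
   [tM_le]), s eps / 4 (from [AM]) and s eps / 8 (from [const]), which is absurd. *)
lra.
Qed.
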